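(* Let $b>-1$ be fixed, and for $\eta>0$ let $\gamma_n=\gamma_n(\eta)$, $n\in\mathbb N=\{1,2,\dots\}$, be the recursion coefficients of the generalized Charlier polynomials. Then for every $n\in\mathbb N$ the function $\gamma_n$ satisfies the third order nonlinear ODE $$\vartheta_\eta\Big(\frac{\gamma_n}{\eta}\big(\vartheta_\eta^2\log\gamma_n+2\gamma_n\big)+n^2\frac{\eta}{\gamma_n}\Big)=2\gamma_n,\qquad \vartheta_\eta:=\eta\frac{d}{d\eta}.$$
   Context: The generalized Charlier weight with parameters $b>-1$, $\eta>0$ is $w(k)=\frac{\eta^k}{(b+1)_k\,k!}$, $k\in\mathbb N_0=\{0,1,2,\dots\}$, where $(x)_k=x(x+1)\cdots(x+k-1)$. The generalized Charlier polynomials $P_n$ are the monic polynomials, $\deg P_n=n$, with $\sum_{k\ge0}P_n(k)P_m(k)w(k)=\delta_{n,m}H_n$; their recursion coefficients are defined by $zP_n(z)=P_{n+1}(z)+\beta_nP_n(z)+\gamma_nP_{n-1}(z)$, $P_{-1}=0$, $P_0=1$. For $n\geq 1$, $\gamma_n=H_n/H_{n-1}>0$. All quantities are viewed as functions of $\eta>0$ with $b$ fixed. *)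

(* Defs.v *)
From HB Require Import structures.
From mathcomp Require Import all_boot all_order all_algebra.
From mathcomp Require Import all_classical all_reals all_analysis.
Import Order.TTheory GRing.Theory Num.Theory.
Import numFieldNormedType.Exports.

Set Implicit Arguments.
Unset Strict Implicit.
Unset Printing Implicit Defensive.

Local Open Scope classical_set_scope.
Local Open Scope ring_scope.

Definition pochhammer (R : realType) (x : R) (k : nat) : R :=
  \prod_(i < k) (x + i%:R).

Definition charlier_weight (R : realType) (b eta : R) (k : nat) : R :=
  eta ^+ k / (pochhammer (b + 1) k * k`!%:R).

(* [P] is the monic orthogonal family for the weight, with squared norms [H];
   recall that [size p] is the degree plus one. *)
Definition gen_charlier (R : realType) (b eta : R)
    (P : nat -> {poly R}) (H : nat -> R) : Prop :=
  (forall n, P n \is monic /\ size (P n) = n.+1) /\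
  (forall n m,
     series (fun k => (P n).[k%:R] * (P m).[k%:R] * charlier_weight b eta k)
       @ \oo --> (n == m)%:R * H n).

(* The match encodes P_{-1} = 0; in particular [gamma 0] is unconstrained. *)
Definition recursion_coefs (R : realType) (P : nat -> {poly R})
    (beta gamma : nat -> R) : Prop :=
  P 0%N = 1 /\
  forall n, 'X * P n =
    P n.+1 + beta n *: P n + gamma n *: (if n is m.+1 then P m else 0).

Definition theta (R : realType) (f : R -> R) : R -> R :=
  fun eta => eta * f^`()%classic eta.

(* Main.v *)
(* Let L_eta be the moment functional p |-> sum_k p(k) w(k), and theta the
   derivation eta d/d eta. Since theta w(k) = k w(k), L_eta satisfies
   theta (L p) = L (theta p + X p), where theta p is taken coefficientwise.
   Applied to L(P_n P_n) = H_n and L(P_n P_(n-1)) = 0 this yields the Toda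
   equations
     theta beta_n = gamma_(n+1) - gamma_n,
     theta gamma_n = gamma_n (beta_n - beta_(n-1)).
   The Pearson equation (k+1)(k+1+b) w(k+1) = eta w(k) yields the string equation
     (beta_n + beta_(n-1) + b + 1 - n) gamma_n = n eta
   by computing L(P_n X(X+b) P_(n-1)(X-1)) = eta L(P_n(X+1) P_(n-1)) in two ways.
   The Toda equations turn theta^2 log gamma_n + 2 gamma_n into
   gamma_(n+1) + gamma_(n-1), and n^2 eta/gamma_n is
   n (beta_n + beta_(n-1) + b + 1 - n). Finally, consecutive string equations give
     theta (gamma_n gamma_(n+1) / eta) = (n+1) gamma_n - n gamma_(n+1),
   and summing up everything cancels but 2 gamma_n. *)

Require Import Defs.
From mathcomp Require Import all_boot all_order all_algebra.
From mathcomp Require Import all_classical all_reals all_analysis.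
From mathcomp Require Import ring.
Import Order.TTheory GRing.Theory Num.Theory.
Import numFieldNormedType.Exports.
Set Implicit Arguments.
Unset Strict Implicit.
Unset Printing Implicit Defensive.

Local Open Scope classical_set_scope.
Local Open Scope ring_scope.

(** * The weight: positivity and the Pearson equation *)

Lemma cvg_series_shift1 (R : realType) (u : R^nat) (l : R) : series u @ \oo --> l ->
  series (fun k => u k.+1) @ \oo --> l - u 0%N.
Proof.
move=> ul.
have -> : series (fun k => u k.+1) = (fun n => series u n.+1 - u 0%N).
  by apply/funext => n; rewrite /series /= big_nat_recl// addrC addKr.
by apply: cvgB; [rewrite (cvg_shiftS (series u))|exact: cvg_cst].
Qed.

Lemma pochhammer_gt0 (R : realType) (x : R) (k : nat) :
  0 < x -> 0 < pochhammer x k.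
Proof. by move=> x0; apply: prodr_gt0 => i _; rewrite ltr_pwDl. Qed.

(** [limn] is meaningful only for a convergent series; [is_cvg_moment] supplies convergence for
    every polynomial. *)
Definition moment (R : realType) (b eta : R) (p : {poly R}) : R :=
  limn (series (fun k => p.[k%:R] * charlier_weight b eta k)).

Section weight.
Variables (R : realType) (b : R).
Hypothesis hb : -1 < b.

Lemma weight_den_neq0 (k : nat) : pochhammer (b + 1) k * k`!%:R != 0.
Proof.
rewrite mulf_neq0 ?pnatr_eq0 -?lt0n ?fact_gt0// gt_eqF// pochhammer_gt0//.
by rewrite -ltrBlDr sub0r.
Qed.

Lemma charlier_weight_gt0 (eta : R) (k : nat) :
  0 < eta -> 0 < charlier_weight b eta k.
Proof.
move=> e0; rewrite divr_gt0 ?exprn_gt0// mulr_gt0 ?ltr0n ?fact_gt0//.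
by rewrite pochhammer_gt0// -ltrBlDr sub0r.
Qed.

Lemma charlier_weightS (eta : R) (k : nat) :
  k.+1%:R * (k.+1%:R + b) * charlier_weight b eta k.+1 =
  eta * charlier_weight b eta k.
Proof.
rewrite /charlier_weight; have := weight_den_neq0 k; have := weight_den_neq0 k.+1.
rewrite /pochhammer big_ord_recr /= factS natrM exprS.
set p := \prod_(i < k) _; rewrite !mulf_eq0 !negb_or -natr1.
by move=> /and3P[/andP[_ h1] h2 _] /andP[h3 h4]; field; rewrite h1 h2 h3 h4.
Qed.

End weight.

(** * The moment functional and orthogonality at a fixed parameter *)

Section moment.
Variables (R : realType) (b eta : R) (P : nat -> {poly R}) (H : nat -> R).
Hypotheses (hb : -1 < b) (eta0 : 0 < eta) (PH : gen_charlier b eta P H).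
Local Notation w := (charlier_weight b eta).
Local Notation L := (moment b eta).

Lemma size_gen_charlier n : size (P n) = n.+1.
Proof. by case: PH => /(_ n)[]. Qed.

Lemma gen_charlier_coef n : (P n)`_n = 1.
Proof.
by case: PH => /(_ n)[/monicP + sP] _; rewrite /lead_coef sP.
Qed.

(** [P n] is monic, so one top term is removed; iterated, this expands [q] in the basis [P]. *)
Lemma size_sub_gen_charlier n (q : {poly R}) :
  (size q <= n.+1)%N -> (size (q - q`_n *: P n)%R <= n)%N.
Proof.
move=> sq; apply/leq_sizeP => j; rewrite leq_eqVlt => /predU1P[<-|nj].
  by rewrite coefB coefZ gen_charlier_coef mulr1 subrr.
rewrite coefB coefZ (nth_default _ (leq_trans sq nj)).
by rewrite [(P n)`_j]nth_default ?size_gen_charlier// mulr0 subr0.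
Qed.

Lemma gen_charlier0 : P 0%N = 1.
Proof.
have /eqP := size_gen_charlier 0; have := gen_charlier_coef 0.
by move=> c /size_poly1P[a a0 Pa]; move: c; rewrite Pa coefC /= => ->.
Qed.

(** Pairing with [P 0 = 1] in [gen_charlier] gives convergence for each [P n], and these span all
    polynomials. *)
Lemma is_cvg_moment p : cvgn (series (fun k => p.[k%:R] * w k)).
Proof.
have [n] := ubnP (size p); elim: n p => [//|n IH] p; rewrite ltnS.
case: n IH => [|n] IH sp.
  have -> : p = 0 by apply/eqP; rewrite -size_poly_leq0.
  rewrite (_ : series _ = cst 0); first exact: is_cvg_cst.
  by apply/funext => n; rewrite /series /= big1// => k _; rewrite horner0 mul0r.
have /IH cq := size_sub_gen_charlier sp.
have cP : cvgn (series (fun k => (P n).[k%:R] * w k)).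
  have [_ /(_ n 0%N)] := PH; rewrite gen_charlier0 => h; apply/cvg_ex; eexists.
  move: h; under [in X in X -> _]eq_fun do rewrite hornerC mulr1; exact.
rewrite (_ : (fun k => _) = (fun k => (p - p`_n *: P n).[k%:R] * w k) +
  p`_n *: (fun k => (P n).[k%:R] * w k)).
  by apply: is_cvg_seriesD => //; exact: is_cvg_seriesZ.
apply/funext => k; rewrite -[RHS]/(_ + p`_n * (_ * _)).
by rewrite hornerD hornerN hornerZ mulrBl mulrA subrK.
Qed.

Lemma momentD p q : L (p + q) = L p + L q.
Proof.
rewrite /moment -lim_seriesD; [|exact: is_cvg_moment..].
congr (limn (series _)); apply/funext => k.
by rewrite -[RHS]/(_ * _ + _ * _) hornerD mulrDl.
Qed.

Lemma momentZ a p : L (a *: p) = a * L p.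
Proof.
rewrite /moment -[RHS]lim_seriesZ; last exact: is_cvg_moment.
congr (limn (series _)); apply/funext => k.
by rewrite -[RHS]/(a * (_ * _)) hornerZ mulrA.
Qed.

Lemma moment0 : L 0 = 0. Proof. by rewrite -(scale0r 0) momentZ mul0r. Qed.

Lemma moment_gen_charlierM n m : L (P n * P m) = (n == m)%:R * H n.
Proof.
have [_ /(_ n m) h] := PH; apply/cvg_lim => //.
by under eq_fun do rewrite hornerM.
Qed.

(** A polynomial of degree n cannot vanish at all n+1 nodes 0, ..., n, so one of the nonnegative
    terms of the series is positive. *)
Lemma moment_sqr_gt0 n (p : {poly R}) : size p = n.+1 -> 0 < L (p * p).
Proof.
move=> sp; have p0 : p != 0 by rewrite -size_poly_eq0 sp.
have ge0 k : 0 <= (p * p).[k%:R] * w k.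
  by rewrite hornerM -expr2 mulr_ge0 ?sqr_ge0// ltW// charlier_weight_gt0.
have [k kn pk] : exists2 k, (k < n.+1)%N & p.[k%:R] != 0.
  apply/not_exists2P => h.
  have : all (root p) [seq k%:R | k <- iota 0 n.+1].
    apply/allP => x /mapP[k]; rewrite mem_iota /= add0n => kn ->.
    by have [//|/negP] := h k; rewrite negbK.
  move/(max_poly_roots p0); rewrite map_inj_uniq; last first.
    by move=> i j /eqP; rewrite eqr_nat => /eqP.
  by move=> /(_ (iota_uniq _ _)); rewrite size_map size_iota sp ltnn.
apply: (@lt_le_trans _ _ (series (fun k => (p * p).[k%:R] * w k) k.+1)).
  rewrite /series /= big_nat_recr//= ltr_wpDl ?sumr_ge0// hornerM.
  by rewrite mulr_gt0 ?charlier_weight_gt0// -expr2 exprn_even_gt0.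
apply: nondecreasing_cvgn_le; last exact: is_cvg_moment.
by apply: nondecreasing_series => i _ _.
Qed.

Lemma gen_charlier_norm_gt0 n : 0 < H n.
Proof.
have := @moment_sqr_gt0 n (P n) (size_gen_charlier n).
by rewrite moment_gen_charlierM eqxx mul1r.
Qed.

(** Expand [q] in P_0, ..., P_n: orthogonality keeps only the P_n term, whose coefficient is that of
    X^n by monicity. Orthogonality arguments thus become readings of coefficients. *)
Lemma moment_gen_charlier_coef n (q : {poly R}) :
  (size q <= n.+1)%N -> L (P n * q) = q`_n * H n.
Proof.
have lower N (r : {poly R}) : (size r <= N)%N -> (N <= n)%N -> L (P n * r) = 0.
  elim: N r => [|N IH] r sr Nn.
    by move: sr; rewrite size_poly_leq0 => /eqP ->; rewrite mulr0 moment0.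
  rewrite -[r](subrK (r`_N *: P N)) mulrDr momentD IH ?size_sub_gen_charlier// 1?ltnW//.
  by rewrite -scalerAr momentZ moment_gen_charlierM gt_eqF// mul0r mulr0 addr0.
move=> sq; rewrite -{1}[q](subrK (q`_n *: P n)) mulrDr momentD.
rewrite (lower n) ?size_sub_gen_charlier// -scalerAr momentZ.
by rewrite moment_gen_charlierM eqxx mul1r add0r.
Qed.

(** The factor X kills the term k = 0, so the sum can be shifted to k+1, where the Pearson equation
    applies and the shift inside [p] is undone. *)
Lemma moment_pearson (p : {poly R}) :
  L ('X * ('X + b%:P) * (p \Po ('X - 1%:P))) = eta * L p.
Proof.
have := @is_cvg_moment ('X * ('X + b%:P) * (p \Po ('X - 1%:P))).
move=> /cvg_series_shift1; rewrite !hornerM hornerX !mul0r subr0 => /cvg_lim.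
rewrite /moment => /(_ (@Rhausdorff R)) <-; rewrite -[RHS]lim_seriesZ; last exact: is_cvg_moment.
congr (limn (series _)); apply/funext => k.
rewrite -[RHS]/(eta * (_ * _)) !hornerM hornerD horner_comp hornerD hornerN.
rewrite hornerX !hornerC -[k.+1%:R - 1](natrB _ (ltn0Sn k)) subn1 mulrAC.
by rewrite charlier_weightS// mulrAC mulrA.
Qed.

End moment.

(** The two top coefficients of p(X+c), by induction on the Horner form. The factor ['X] makes [n]
    the index of the subleading coefficient, with value 0 at [n = 0]. *)
Lemma coef_comp_poly_XaddC (R : idomainType) (p : {poly R}) (c : R) (n : nat) :
  (size p <= n.+1)%N ->
  (p \Po ('X + c%:P))`_n = p`_n /\
  ('X * (p \Po ('X + c%:P)))`_n = ('X * p)`_n + n%:R * c * p`_n.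
Proof.
elim/poly_ind: p n => [|p a IH] n sp.
  by rewrite comp_poly0 mulr0 !coef0 mulr0 addr0.
rewrite comp_polyD comp_polyM comp_polyX comp_polyC.
case: n sp => [|n] sp.
  have -> : p = 0.
    move: sp; rewrite size_MXaddC; case: ifP => [/andP[/eqP]//|_].
    by rewrite ltnS leqn0 size_poly_eq0 => /eqP.
  by rewrite comp_poly0 !mul0r !add0r addr0.
have sp' : (size p <= n.+1)%N.
  by move: sp; rewrite size_MXaddC; case: ifP => [/andP[/eqP-> _]|//]; rewrite size_poly0.
have [h1 h2] := IH n sp'.
set q := p \Po _ in h1 h2 *.
have qn : q`_n.+1 = 0 by rewrite nth_default// /q size_comp_poly2// size_XaddC.
have coefXa (r : {poly R}) i : (r * ('X + a%:P))`_i = ('X * r)`_i + a * r`_i.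
  by rewrite mulrDr [r * 'X]mulrC coefD coefMC mulrC [r`_i * _]mulrC.
have coefXc (r : {poly R}) i : (r * ('X + c%:P))`_i = ('X * r)`_i + c * r`_i.
  by rewrite mulrDr [r * 'X]mulrC coefD coefMC [r`_i * _]mulrC.
rewrite [p * 'X]mulrC; split.
  by rewrite !coefD coefXc coefXM coefXM /= h1 qn mulr0 addr0.
rewrite [LHS]coefXM [X in _ = X + _]coefXM /= !coefD coefXc h1 h2.
rewrite [('X * p)`_n.+1]coefXM [a%:P`_n.+1]coefC /= addr0 -natr1.
by ring.
Qed.

(** * Derivatives of functions known on the positive half-line *)

Section is_derive_extra.
Variable R : realType.
Implicit Types (f g : R -> R) (t : R).

(** The positive half-line is a neighbourhood of each of its points; the identities in the parameter
    are available only there. *)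
Lemma pos_near_eq_is_derive f g t d : 0 < t ->
  (forall s, 0 < s -> f s = g s) -> is_derive t 1 f d -> is_derive t 1 g d.
Proof.
move=> t0 fg; apply: near_eq_is_derive.
by near=> s; apply: fg; near: s; exact: lt_nbhsr.
Unshelve. all: by end_near. Qed.

Lemma pos_near_eq_derivable f g t d : 0 < t ->
  (forall s, 0 < s -> f s = g s) -> is_derive t 1 f d -> derivable g t 1.
Proof. by move=> t0 fg /(pos_near_eq_is_derive t0 fg)[]. Qed.

Lemma is_deriveD_fun f g t df dg : is_derive t 1 f df -> is_derive t 1 g dg ->
  is_derive t 1 (fun s => f s + g s) (df + dg).
Proof. exact: is_deriveD. Qed.

Lemma is_deriveB_fun f g t df dg : is_derive t 1 f df -> is_derive t 1 g dg ->
  is_derive t 1 (fun s => f s - g s) (df - dg).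
Proof. exact: is_deriveB. Qed.

Lemma is_deriveM_fun f g t df dg : is_derive t 1 f df -> is_derive t 1 g dg ->
  is_derive t 1 (fun s => f s * g s) (f t * dg + df * g t).
Proof. by move=> hf hg; rewrite [df * _]mulrC; exact: is_deriveM. Qed.

Lemma is_derive_div f g t df dg : g t != 0 ->
  is_derive t 1 f df -> is_derive t 1 g dg ->
  is_derive t 1 (fun s => f s / g s) ((df * g t - f t * dg) / g t ^+ 2).
Proof.
move=> gt0 hf hg; apply: is_derive_eq (is_deriveM_fun hf (is_deriveV gt0 hg)) _.
by rewrite -[_ *: _]/(_ * _); field.
Qed.

Lemma is_derive_sum_fun n (f : 'I_n -> R -> R) t (df : 'I_n -> R) :
  (forall i, is_derive t 1 (f i) (df i)) ->
  is_derive t 1 (fun s => \sum_(i < n) f i s) (\sum_(i < n) df i).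
Proof.
move=> h; rewrite (_ : (fun s => _) = \sum_(i < n) f i); first exact: is_derive_sum.
by apply/funext => s; rewrite fct_sumE.
Qed.

Lemma is_derive_unique f t d1 d2 :
  is_derive t 1 f d1 -> is_derive t 1 f d2 -> d1 = d2.
Proof. by move=> h1 h2; rewrite -(@derive_val _ _ _ _ _ _ _ h1) derive_val. Qed.

Lemma is_derive_derive1 f t d : is_derive t 1 f d -> f^`()%classic t = d.
Proof. by move=> h; rewrite derive1E derive_val. Qed.

End is_derive_extra.

(** * Differentiation of polynomials and moments in the parameter *)

Lemma cvg_pseries_diffs (R : realType) (c : R^nat) (x l : R) : x != 0 ->
  pseries (fun k => k%:R * c k) x @ \oo --> l ->
  pseries (pseries_diffs c) x @ \oo --> l / x.
Proof.
(* The term of index 0 carries the factor 0, so the shift keeps the limit; the surplus power of [x]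
   is then divided out. *)
move=> x0 /cvg_series_shift1 /=; rewrite !mul0r subr0 => h.
have -> : pseries (pseries_diffs c) x =
    (fun n => series (fun k => k.+1%:R * c k.+1 * x ^+ k.+1) n / x).
  apply/funext => n; rewrite /pseries /series /= mulr_suml.
  by apply: eq_bigr => k _; rewrite exprSr mulrA mulfK.
by apply: cvgM => //; exact: cvg_cst.
Qed.

(* The uniform bound on the sizes makes [dp] a polynomial and reduces the
   derivative of a moment to a finite sum. *)
Definition poly_derive (R : realType) (p : R -> {poly R}) (t : R)
    (dp : {poly R}) : Prop :=
  (exists N, forall s, 0 < s -> (size (p s) <= N)%N) /\
  forall i, is_derive t 1 (fun s => (p s)`_i) dp`_i.

Section poly_derive.
Variables (R : realType) (t : R).
Hypothesis t0 : 0 < t.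
Implicit Types p q : R -> {poly R}.

(** Serves to bound the degree of [dp]: a constant leading coefficient, or a zero above the size
    bound, drops out. *)
Lemma poly_derive_coef_eq0 p dp i : poly_derive p t dp ->
  (exists a, forall s, 0 < s -> (p s)`_i = a) -> dp`_i = 0.
Proof.
move=> [_ /(_ i) h] [a pa]; apply: (is_derive_unique h).
by apply: (@pos_near_eq_is_derive _ (cst a)) => // s s0; rewrite pa.
Qed.

Lemma poly_derive_cst (a : {poly R}) : poly_derive (cst a) t 0.
Proof.
split=> [|i]; first by exists (size a).
by rewrite coef0; exact: (is_derive_cst a`_i).
Qed.

Lemma poly_deriveM p q dp dq : poly_derive p t dp -> poly_derive q t dq ->
  poly_derive (fun s => p s * q s) t (p t * dq + dp * q t).
Proof.
move=> [[N pN] hp] [[M qM] hq]; split=> [|i].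
  exists (N + M)%N => s s0; apply: leq_trans (size_polyMleq _ _) _.
  by rewrite (leq_trans (leq_pred _))// leq_add ?pN ?qM.
under eq_fun do rewrite coefM.
rewrite coefD !coefM -big_split /=; apply: is_derive_sum_fun => j.
exact: is_deriveM_fun.
Qed.

Lemma derivable_poly_derive p :
  (exists N, forall s, 0 < s -> (size (p s) <= N)%N) ->
  (forall i, derivable (fun s => (p s)`_i) t 1) -> exists dp, poly_derive p t dp.
Proof.
move=> [N pN] dp; exists (\poly_(i < N) 'D_1 (fun s => (p s)`_i) t).
split=> [|i]; first by exists N.
rewrite coef_poly; case: ifPn => [_|]; first exact: derivableP.
rewrite -leqNgt => Ni; apply: (@pos_near_eq_is_derive _ (cst 0)) => // s s0.
by rewrite nth_default// (leq_trans (pN _ s0)).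
Qed.

End poly_derive.

Section moment_derive.
Variables (R : realType) (b : R) (P : R -> nat -> {poly R}) (H : R -> nat -> R).
Hypothesis hP : forall eta : R, 0 < eta -> gen_charlier b eta (P eta) (H eta).

Lemma cvg_moment (t : R) (p : {poly R}) : 0 < t ->
  pseries (fun k => p.[k%:R] / (pochhammer (b + 1) k * k`!%:R)) t @ \oo -->
  moment b t p.
Proof.
move=> t0; have := @is_cvg_moment _ _ _ _ _ (hP t0) p; rewrite /moment.
rewrite (_ : (fun k => _ * charlier_weight _ _ _) = (fun k =>
  p.[k%:R] / (pochhammer (b + 1) k * k`!%:R) * t ^+ k)); first by [].
by apply/funext => k; rewrite mulrA mulrAC.
Qed.

(** For fixed [p] the moment is a power series in the parameter. Differentiating it termwise needs
    convergence of the series and of its first two formal derivatives at a point beyond [t]; [t + 1]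
    is taken. *)
Lemma is_derive_moment (t : R) (p : {poly R}) : 0 < t ->
  is_derive t 1 (fun s => moment b s p) (moment b t ('X * p) / t).
Proof.
move=> t0; pose c (q : {poly R}) k := q.[k%:R] / (pochhammer (b + 1) k * k`!%:R).
have cX q k : k%:R * c q k = c ('X * q) k by rewrite /c hornerM hornerX mulrA.
have cvg_diffs q (s : R) : 0 < s ->
    pseries (pseries_diffs (c q)) s @ \oo --> moment b s ('X * q) / s.
  move=> s0; apply: cvg_pseries_diffs; first by rewrite gt_eqF.
  by under eq_fun do rewrite cX; exact: cvg_moment.
have K0 : 0 < t + 1 by rewrite addr_gt0.
have lt_tK : `|t| < `|t + 1| by rewrite !gtr0_norm// ltrDl.
have dd : cvgn (pseries (pseries_diffs (pseries_diffs (c p))) (t + 1)).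
  (* As k (k+1) c_(k+1) is the formal derivative of the sequence (k-1) c_k, the second formal
     derivative is again a moment, that of X (X-1) p, divided twice by the argument. *)
  apply/cvg_ex; exists (moment b (t + 1) ('X * (('X - 1%:P) * p)) / (t + 1) / (t + 1)).
  apply: cvg_pseries_diffs; first by rewrite gt_eqF.
  under eq_fun => k.
    rewrite (_ : _ * _ = pseries_diffs (c (('X - 1%:P) * p)) k); last first.
      rewrite /pseries_diffs /c hornerM hornerD hornerN hornerX hornerC.
      by rewrite -natr1 addrK; ring.
    over.
  exact: cvg_diffs.
have := pseries_snd_diffs (cvgP _ (@cvg_moment _ p K0)) (cvgP _ (cvg_diffs p (t + 1) K0)) dd lt_tK.
rewrite (cvg_lim _ (cvg_diffs p t t0))//; apply: pos_near_eq_is_derive => // s s0.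
by apply/cvg_lim => //; exact: cvg_moment.
Qed.

Lemma moment_coef (t : R) (p : {poly R}) (N : nat) : 0 < t ->
  (size p <= N)%N -> moment b t p = \sum_(i < N) p`_i * moment b t 'X^i.
Proof.
move=> t0 pN; have [mD mZ] := (momentD (hP t0), momentZ (hP t0)).
have {1}-> : p = \sum_(i < N) p`_i *: 'X^i.
  by rewrite -poly_def; apply/polyP => i; rewrite coef_poly; case: ltnP => // Ni;
    rewrite nth_default// (leq_trans pN).
rewrite (@big_morph _ _ (moment b t) 0 +%R)//; last exact: (moment0 (hP t0)).
by apply: eq_bigr => i _; rewrite mZ.
Qed.

(** The product rule on the finite sum of coefficients times monomial moments. *)
Lemma is_derive_moment_poly (t : R) (p : R -> {poly R}) (dp : {poly R}) :
  0 < t -> poly_derive p t dp ->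
  is_derive t 1 (fun s => moment b s (p s))
    (moment b t dp + moment b t ('X * p t) / t).
Proof.
move=> t0 hp; have [[N pN] dpi] := hp.
have sdp : (size dp <= N)%N.
  apply/leq_sizeP => i Ni; apply: (poly_derive_coef_eq0 t0 hp).
  by exists 0 => s s0; rewrite nth_default// (leq_trans (pN _ s0)).
apply: (@pos_near_eq_is_derive _ (fun s => \sum_(i < N) (p s)`_i * moment b s 'X^i)) => //.
  by move=> s s0; rewrite (moment_coef s0 (pN _ s0)).
apply: is_derive_eq (is_derive_sum_fun (fun i : 'I_N =>
  is_deriveM_fun (dpi i) (is_derive_moment 'X^i t0))) _.
rewrite big_split /= addrC -(moment_coef t0 sdp); congr (_ + _).
have {2}-> : p t = \sum_(i < N) (p t)`_i *: 'X^i.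
  by rewrite -poly_def; apply/polyP => i; rewrite coef_poly; case: ltnP => // Ni;
    rewrite nth_default// (leq_trans (pN _ t0)).
rewrite mulr_sumr (@big_morph _ _ (moment b t) 0 +%R); last 2 first.
- exact: (momentD (hP t0)).
- exact: (moment0 (hP t0)).
rewrite mulr_suml; apply: eq_bigr => i _.
by rewrite -[in RHS]scalerAr (momentZ (hP t0)) mulrA.
Qed.

End moment_derive.

(** * Norms, recursion coefficients and the string equation *)

Section toda.
Variables (R : realType) (b : R) (P : R -> nat -> {poly R}) (H beta gamma : R -> nat -> R).
Hypotheses (hb : -1 < b)
  (hP : forall t : R, 0 < t -> gen_charlier b t (P t) (H t))
  (hrec : forall t : R, 0 < t -> recursion_coefs (P t) (beta t) (gamma t)).
Local Notation L := (moment b).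

(* [gamma t 0] is unconstrained; the convention [gamma_0 = 0] makes the
   recursion, the Toda and the string equations uniform in [n]. *)
Let g (t : R) (n : nat) : R := if n is m.+1 then gamma t m.+1 else 0.

(* The subleading coefficient of [P t n], also for [n = 0], where it is [0]. *)
Let s (t : R) (n : nat) : R := ('X * P t n)`_n.

Section fixed_argument.
Variable t : R.
Hypothesis t0 : 0 < t.
Let PH := hP t0.

Lemma three_term n : 'X * P t n = P t n.+1 + beta t n *: P t n + g t n *: P t n.-1.
Proof.
have [_ /(_ n) ->] := hrec t0; congr (_ + _).
by case: n => [|n] /=; rewrite ?scaler0 ?scale0r.
Qed.

Lemma size_X_gen_charlier n : size ('X * P t n) = n.+2.
Proof.
by rewrite mulrC size_mulX ?(size_gen_charlier PH)// -size_poly_eq0 (size_gen_charlier PH).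
Qed.

(** Compare coefficients of index [n] in the recursion; its last term contributes nothing. *)
Lemma beta_subleading n : beta t n = s t n - s t n.+1.
Proof.
rewrite /s [X in _ - X]coefXM /= three_term !coefD !coefZ (gen_charlier_coef PH) mulr1.
case: n => [|n] /=; first by rewrite mul0r addr0 addrAC subrr add0r.
rewrite [(P t n)`_n.+1]nth_default ?(size_gen_charlier PH)// mulr0 addr0.
by rewrite addrAC subrr add0r.
Qed.

Lemma moment_X_sqr n : L t (P t n * ('X * P t n)) = beta t n * H t n.
Proof.
rewrite three_term !mulrDr -!scalerAr !(momentD PH) !(momentZ PH).
rewrite !(moment_gen_charlierM PH) eqxx mul1r (ltn_eqF (ltnSn n)) mul0r add0r.
case: n => [|n] /=; first by rewrite mul0r addr0.
by rewrite (gtn_eqF (ltnSn n)) mul0r mulr0 addr0.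
Qed.

Lemma moment_X_succ n : L t ('X * (P t n.+1 * P t n)) = H t n.+1.
Proof.
rewrite mulrCA (moment_gen_charlier_coef PH) ?size_X_gen_charlier//.
by rewrite coefXM /= (gen_charlier_coef PH) mul1r.
Qed.

(** L(X P_(n+1) P_n) in two ways: X applied to P_n gives H_(n+1), X applied to P_(n+1) leaves
    gamma_(n+1) H_n by the recursion. *)
Lemma gamma_norm n : gamma t n.+1 * H t n = H t n.+1.
Proof.
rewrite -[RHS]moment_X_succ [P t n.+1 * _]mulrC mulrCA three_term.
rewrite !mulrDr -!scalerAr !(momentD PH) !(momentZ PH) !(moment_gen_charlierM PH).
rewrite (ltn_eqF (ltnSn n)) (ltn_eqF (leqnSn n.+1)) eqxx.
by rewrite !mul0r mulr0 !add0r mul1r.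
Qed.

Lemma norm_neq0 n : H t n != 0.
Proof. by rewrite gt_eqF// (gen_charlier_norm_gt0 hb t0 PH). Qed.

Lemma gamma_eq n : gamma t n.+1 = H t n.+1 / H t n.
Proof. by rewrite -gamma_norm mulfK// norm_neq0. Qed.

Lemma gamma_gt0 n : 0 < gamma t n.+1.
Proof. by rewrite gamma_eq divr_gt0// (gen_charlier_norm_gt0 hb t0 PH). Qed.

Lemma beta_eq n : beta t n = L t (P t n * ('X * P t n)) / H t n.
Proof. by rewrite moment_X_sqr mulfK// norm_neq0. Qed.

Lemma string_equation n :
  (beta t n + beta t n.-1 + b + 1 - n%:R) * g t n = n%:R * t.
Proof.
case: n => [|m] /=; first by rewrite mulr0 mul0r.
pose r := P t m \Po ('X - 1%:P); pose e := P t m.+1 \Po ('X + 1%:P).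
have sP n : (size (P t n) <= n.+1)%N by rewrite (size_gen_charlier PH).
have [em1 em] := coef_comp_poly_XaddC 1 (sP m.+1).
have [rm rm1] := coef_comp_poly_XaddC (-1) (sP m).
move: rm rm1; rewrite rmorphN -/r (gen_charlier_coef PH) => rm rm1.
move: em1 em; rewrite -/e (gen_charlier_coef PH) => em1 em.
have sr : size r = m.+1 by rewrite /r size_comp_poly2 ?size_XsubC ?(size_gen_charlier PH).
have se : size e = m.+2 by rewrite /e size_comp_poly2 ?size_XaddC ?(size_gen_charlier PH).
(* The shift in [moment_pearson] turns [e] back into P_(m+1) and P_m into [r]. *)
have := moment_pearson hb PH (e * P t m).
rewrite comp_polyM -/r (_ : e \Po _ = P t m.+1); last first.
  rewrite /e -comp_polyA comp_polyD comp_polyX comp_polyC subrK comp_polyXr//.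
(* [e] minus P_(m+1) has degree at most m, with coefficient m+1 at X^m. *)
have -> : L t (e * P t m) = m.+1%:R * H t m.
  rewrite -[e](subrK (P t m.+1)) mulrDl (momentD PH) (moment_gen_charlierM PH).
  rewrite gtn_eqF// mul0r addr0 mulrC (moment_gen_charlier_coef PH); last first.
    by have := @size_sub_gen_charlier _ _ _ _ _ PH m.+1 e; rewrite em1 scale1r se; exact.
  by move: em; rewrite !coefXM /= coefB => ->; rewrite !mulr1 addrC addKr.
set q := 'X * ('X + b%:P) * r.
have qE j : q`_j.+1 = ('X * r)`_j + b * r`_j.
  by rewrite /q -mulrA coefXM /= mulrDl coefD coefCM.
(* Both [q] and X P_(m+1) are monic of degree m+2, so their difference has degree at most m+1 and
   pairs with P_(m+1) through one coefficient. *)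
rewrite mulrCA -/q -[q](subrK ('X * P t m.+1)) mulrDr (momentD PH) moment_X_sqr.
rewrite (moment_gen_charlier_coef PH); last first.
  apply/leq_sizeP => j; case: j => // j; rewrite ltnS leq_eqVlt => /predU1P[<-|mj].
    rewrite coefB qE !coefXM /= rm (gen_charlier_coef PH).
    by rewrite nth_default ?sr// mulr0 addr0 subrr.
  rewrite coefB qE nth_default ?[r`_j]nth_default ?sr//; last 2 first.
  - by rewrite ltnW.
  - by rewrite mulrC size_mulX ?sr// -size_poly_eq0 sr.
  by rewrite nth_default ?size_X_gen_charlier// mulr0 addr0 subr0.
rewrite coefB qE rm1 rm gamma_eq => h.
rewrite mulrA; apply: (canLR (mulfK (norm_neq0 m))).
transitivity (t * (m.+1%:R * H t m)); last by rewrite mulrCA mulrA.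
by rewrite -h (beta_subleading m) /s -natr1; ring.
Qed.

End fixed_argument.

(** * Differentiability in the parameter and the Toda equations *)

Section derivatives.
Variable t : R.
Hypothesis t0 : 0 < t.
Let PH := hP t0.

Lemma size_gen_charlier_bound n :
  exists N, forall u : R, 0 < u -> (size (P u n) <= N)%N.
Proof. by exists n.+1 => u u0; rewrite (size_gen_charlier (hP u0)). Qed.

Lemma norm_derivable n dP : poly_derive (P^~ n) t dP ->
  derivable (H^~ n) t 1.
Proof.
move=> h; have hM := is_derive_moment_poly hP t0 (poly_deriveM h h).
apply: (pos_near_eq_derivable t0 _ hM) => u u0.
by rewrite (moment_gen_charlierM (hP u0)) eqxx mul1r.
Qed.

Lemma beta_derivable n dP : poly_derive (P^~ n) t dP ->
  derivable (beta^~ n) t 1.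
Proof.
move=> h; have /derivableP dH := norm_derivable h.
have hX := poly_deriveM (poly_derive_cst t 'X) h.
have hM := is_derive_moment_poly hP t0 (poly_deriveM h hX).
apply: (pos_near_eq_derivable t0 _ (is_derive_div (norm_neq0 t0 n) hM dH)) => u u0.
by rewrite (beta_eq u0).
Qed.

Lemma gamma_derivable n dP dQ :
  poly_derive (P^~ n) t dP -> poly_derive (P^~ n.+1) t dQ ->
  derivable (gamma^~ n.+1) t 1.
Proof.
move=> /norm_derivable/derivableP dH /norm_derivable/derivableP dH1.
apply: (pos_near_eq_derivable t0 _ (is_derive_div (norm_neq0 t0 n) dH1 dH)) => u u0.
by rewrite (gamma_eq u0).
Qed.

Lemma poly_derive_gen_charlierS n dP dQ :
  poly_derive (P^~ n) t dP -> poly_derive (P^~ n.-1) t dQ ->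
  derivable (g^~ n) t 1 -> exists dP1, poly_derive (P^~ n.+1) t dP1.
Proof.
move=> hP0 hP1 /derivableP dg; have /derivableP db := beta_derivable hP0.
apply: derivable_poly_derive => // [|i]; first exact: size_gen_charlier_bound.
have [_ /(_ i) hX] := poly_deriveM (poly_derive_cst t 'X) hP0.
have hbP := is_deriveM_fun db (hP0.2 i); have hgP := is_deriveM_fun dg (hP1.2 i).
apply: (pos_near_eq_derivable t0 _ (is_deriveB_fun (is_deriveB_fun hX hbP) hgP)) => u u0 /=.
by rewrite (three_term u0) !coefD !coefZ; ring.
Qed.

(** Differentiability climbs the recursion: P_n and P_(n+1) yield the norms, hence beta_(n+1) and
    gamma_(n+1), hence P_(n+2). The induction therefore carries two consecutive indices. *)
Lemma poly_derive_gen_charlier n : exists dP, poly_derive (P^~ n) t dP.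
Proof.
have base : poly_derive (P^~ 0%N) t 0.
  split=> [|i]; first exact: size_gen_charlier_bound.
  apply: (pos_near_eq_is_derive t0 _ ((poly_derive_cst t 1).2 i)) => u u0.
  by rewrite (gen_charlier0 (hP u0)).
suff [] : (exists dP, poly_derive (P^~ n) t dP) /\
          (exists dP, poly_derive (P^~ n.+1) t dP) by [].
elim: n => [|n [[dP hn] [dQ hn1]]]; split; [by exists 0| |by exists dQ|].
  (* At index 0 the predecessor is 0 again, and [g] is constantly 0 there. *)
  by apply: (poly_derive_gen_charlierS base base); exact: derivable_cst.
by apply: (poly_derive_gen_charlierS hn1 hn); exact: (gamma_derivable hn hn1).
Qed.

Lemma size_poly_derive_gen_charlier n dP :
  poly_derive (P^~ n) t dP -> (size dP <= n)%N.
Proof.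
move=> h; apply/leq_sizeP => i ni; apply: (poly_derive_coef_eq0 t0 h).
exists (i == n)%:R => u u0; move: ni; rewrite leq_eqVlt => /predU1P[<-|ni].
  by rewrite (gen_charlier_coef (hP u0)) eqxx.
by rewrite nth_default ?(size_gen_charlier (hP u0))// gtn_eqF.
Qed.

(** Differentiate L(P_n P_n): the derivative of P_n has lower degree, hence is orthogonal to P_n,
    and only L(X P_n P_n) / t survives. *)
Lemma norm_toda n : is_derive t 1 (H^~ n) (beta t n * H t n / t).
Proof.
have [dP h] := poly_derive_gen_charlier n.
have hM := is_derive_moment_poly hP t0 (poly_deriveM h h).
have dPn := size_poly_derive_gen_charlier h.
apply: (@pos_near_eq_is_derive _ (fun u => L u (P u n * P u n))) => //.
  by move=> u u0; rewrite (moment_gen_charlierM (hP u0)) eqxx mul1r.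
apply: is_derive_eq hM _; rewrite [dP * _]mulrC (momentD PH).
rewrite (moment_gen_charlier_coef PH) ?(leq_trans dPn)//.
by rewrite nth_default// mul0r !add0r mulrCA (moment_X_sqr t0).
Qed.

(** Differentiating L(P_(n+1) P_n) = 0 leaves the derivative of the subleading coefficient times
    H_n, plus H_(n+1) / t. *)
Lemma subleading_toda n : is_derive t 1 (s^~ n) (- g t n / t).
Proof.
case: n => [|n].
  rewrite oppr0 mul0r; apply: (@pos_near_eq_is_derive _ (cst 0)) => //.
  by move=> u u0; rewrite /s coefXM.
have [dP h] := poly_derive_gen_charlier n.+1; have [dQ hQ] := poly_derive_gen_charlier n.
apply: (@pos_near_eq_is_derive _ (fun u => (P u n.+1)`_n)) => //.
  by move=> u u0; rewrite /s coefXM.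
apply: is_derive_eq (h.2 n) _.
have dPn := size_poly_derive_gen_charlier h.
have dQn := size_poly_derive_gen_charlier hQ.
have hM := is_derive_moment_poly hP t0 (poly_deriveM h hQ).
have : is_derive t 1 (fun u => L u (P u n.+1 * P u n)) 0.
  apply: (@pos_near_eq_is_derive _ (cst 0)) => // u u0.
  by rewrite (moment_gen_charlierM (hP u0)) gtn_eqF// mul0r.
move=> /is_derive_unique -/(_ _ hM).
rewrite (momentD PH) (moment_X_succ t0) [dP * _]mulrC.
rewrite !(moment_gen_charlier_coef PH) ?(leq_trans dQn) ?(leq_trans (leqnSn n))//.
rewrite [dQ`__]nth_default ?(leq_trans dQn)// mul0r add0r => /esym/eqP.
rewrite addr_eq0 => /eqP dPH; apply: (mulIf (norm_neq0 t0 n)).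
by rewrite dPH /= -(gamma_norm t0) !mulNr mulrAC.
Qed.

Lemma beta_toda n : is_derive t 1 (beta^~ n) ((g t n.+1 - g t n) / t).
Proof.
apply: (@pos_near_eq_is_derive _ (fun u => s u n - s u n.+1)) => //.
  by move=> u u0; rewrite (beta_subleading u0).
apply: is_derive_eq (is_deriveB_fun (subleading_toda n) (subleading_toda n.+1)) _.
by rewrite -mulrBl opprK addrC.
Qed.

Lemma gamma_toda n : is_derive t 1 (g^~ n) (g t n * (beta t n - beta t n.-1) / t).
Proof.
case: n => [|n]; first by rewrite !mul0r; exact: is_derive_cst.
apply: (@pos_near_eq_is_derive _ (fun u => H u n.+1 / H u n)) => //.
  by move=> u u0; rewrite -(gamma_eq u0).
apply: is_derive_eq (is_derive_div (norm_neq0 t0 n) (norm_toda n.+1) (norm_toda n)) _.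
rewrite /= (gamma_eq t0); have := norm_neq0 t0 n; have : t != 0 by rewrite gt_eqF.
by move=> h1 h2; field; rewrite h1 h2.
Qed.

End derivatives.

(** * The third order equation *)

Section ode.
Variable m : nat.
Let n := m.+1.

(** The Toda equations write [d1] and [d2], the first two derivatives, as expressions in [t], [g]
    and [beta], which are differentiable again. *)
Lemma gamma_derivable3 (t : R) (k : nat) : 0 < t -> (k < 3)%N ->
  derivable (derive1n k (gamma^~ n)) t 1.
Proof.
pose d1 u := g u n * (beta u n - beta u m) / u.
pose d2 u := (d1 u * (beta u n - beta u m) +
   g u n * ((g u n.+1 - g u n) / u - (g u n - g u m)/ u)) / u - d1 u / u.
have D1 (u : R) : 0 < u -> is_derive u 1 (gamma^~ n) (d1 u).
  by move=> u0; exact: (gamma_toda u0 n).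
have D2 (u : R) : 0 < u -> is_derive u 1 d1 (d2 u).
  move=> u0; have un0 : u != 0 by rewrite gt_eqF.
  apply: is_derive_eq (is_derive_div un0 (is_deriveM_fun (gamma_toda u0 n)
    (is_deriveB_fun (beta_toda u0 n) (beta_toda u0 m))) (is_derive_id u 1)) _.
  by rewrite /d2 /d1 /=; field.
have D3 (u : R) : 0 < u -> derivable d2 u 1.
  move=> u0; have un0 : u != 0 by rewrite gt_eqF.
  have hid := is_derive_id u (1 : R).
  have hB := is_deriveB_fun (beta_toda u0 n) (beta_toda u0 m).
  have hG1 := is_derive_div un0 (is_deriveB_fun (gamma_toda u0 n.+1) (gamma_toda u0 n)) hid.
  have hG := is_derive_div un0 (is_deriveB_fun (gamma_toda u0 n) (gamma_toda u0 m)) hid.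
  have h1 := is_deriveM_fun (D2 u u0) hB.
  have h2 := is_deriveM_fun (gamma_toda u0 n) (is_deriveB_fun hG1 hG).
  by have [] := is_deriveB_fun (is_derive_div un0 (is_deriveD_fun h1 h2) hid)
    (is_derive_div un0 (D2 u u0) hid).
have E1 (u : R) : 0 < u -> (gamma^~ n)^`()%classic u = d1 u.
  by move=> u0; exact: is_derive_derive1 (D1 u u0).
have D2' (u : R) : 0 < u -> is_derive u 1 ((gamma^~ n)^`())%classic (d2 u).
  by move=> u0; apply: pos_near_eq_is_derive (D2 u u0) => // v v0; rewrite E1.
move=> t0; case: k => [|[|[|//]]] _ /=.
- by case: (D1 t t0).
- by case: (D2' t t0).
- - apply: pos_near_eq_derivable (derivableP (D3 t t0)) => // v v0.
  by rewrite (is_derive_derive1 (D2' v v0)).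
Qed.

Lemma theta2_ln_gamma (t : R) : 0 < t ->
  theta (theta (fun u => ln (gamma u n))) t = g t n.+1 - 2 * g t n + g t m.
Proof.
move=> t0.
have th1 (u : R) : 0 < u -> theta (fun u => ln (gamma u n)) u = beta u n - beta u m.
  move=> u0; have gu0 := gamma_gt0 u0 m.
  have hln : is_derive u 1 (fun u => ln (gamma u n))
      ((gamma u n)^-1 * (g u n * (beta u n - beta u m) / u)).
    exact: (is_derive1_comp (is_derive1_ln gu0) (gamma_toda u0 n)).
  rewrite /theta (is_derive_derive1 hln) /=; field.
  by rewrite !gt_eqF.
have hB := is_deriveB_fun (beta_toda t0 n) (beta_toda t0 m).
rewrite {1}/theta (_ : _^`()%classic t = (g t n.+1 - g t n) / t - (g t n - g t m) / t).
  by field; rewrite gt_eqF.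
apply: is_derive_derive1; apply: pos_near_eq_is_derive hB => // u u0.
by rewrite th1.
Qed.

Lemma gen_charlier_ode (t : R) : 0 < t ->
  theta (fun u : R => gamma u n / u *
      (theta (theta (fun v : R => ln (gamma v n))) u + 2 * gamma u n)
      + n%:R ^+ 2 * (u / gamma u n)) t = 2 * gamma t n.
Proof.
move=> t0; have tn0 : t != 0 by rewrite gt_eqF.
have hG := is_deriveM_fun (gamma_toda t0 n)
  (is_deriveD_fun (gamma_toda t0 n.+1) (gamma_toda t0 m)).
have hB := is_deriveD_fun (is_deriveD_fun (beta_toda t0 n) (beta_toda t0 m))
  (is_derive_cst (b + 1 - n%:R) t (1 : R)).
(* Derivative of the simplified bracket g_n (g_(n+1) + g_(n-1)) / t + n (beta_n + beta_(n-1) + b + 1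
   - n). *)
have hF := is_deriveD_fun (is_derive_div tn0 hG (is_derive_id t 1))
  (is_deriveM_fun (is_derive_cst (n%:R : R) t (1 : R)) hB).
have S1 : (beta t n.+1 + beta t n + b + 1 - n.+1%:R) * g t n.+1 = n.+1%:R * t.
  exact: string_equation t0 n.+1.
have S2 : (beta t n + beta t m + b + 1 - n%:R) * g t n = n%:R * t.
  exact: string_equation t0 n.
have S3 := string_equation t0 m.
(* Cross-multiplying consecutive string equations by [g] and subtracting cancels the shared beta;
   the -1 comes from differentiating 1/t. *)
have K1 : g t n * g t n.+1 * (beta t n.+1 - beta t m - 1) =
    t * (n.+1%:R * g t n - n%:R * g t n.+1).
  transitivity (n.+1%:R * t * g t n - n%:R * t * g t n.+1); last by ring.
  by rewrite -S1 -S2 -natr1; ring.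
have K2 : g t n * g t m * (beta t n - beta t m.-1 - 1) =
    t * (n%:R * g t m - m%:R * g t n).
  transitivity (n%:R * t * g t m - m%:R * t * g t n); last by ring.
  by rewrite -S2 -S3 /n -natr1; ring.
rewrite /theta (is_derive_derive1 (pos_near_eq_is_derive t0 _ hF)) => [|u u0].
  transitivity ((t * (n.+1%:R * g t n - n%:R * g t n.+1) +
      t * (n%:R * g t m - m%:R * g t n)) / t + n%:R * (g t n.+1 - g t m)).
    by rewrite -K1 -K2 /cst; cbv beta; field.
  (* The neighbours g_(n+1) and g_(n-1) cancel; (n+1) - m = 2 remains as the factor of g_n. *)
  by rewrite -[n.+1%:R]natr1 -[n%:R]natr1 -[gamma t n]/(g t n); field.
rewrite -/(theta _) -/(theta _ u) theta2_ln_gamma//.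
have S : (beta u n + beta u m + b + 1 - n%:R) * gamma u n = n%:R * u.
  exact: string_equation u0 n.
have gu0 := gamma_gt0 u0 m; have gn0 : gamma u n != 0 by rewrite gt_eqF.
(* One factor n of n^2 is absorbed by the string equation, which removes the division by gamma_n. *)
rewrite expr2 mulrA -(mulrA n%:R) -S /=.
by field; rewrite gn0 gt_eqF.
Qed.

End ode.

End toda.

Theorem theorem4 (R : realType) (b : R) (hb : -1 < b)
    (P : R -> nat -> {poly R}) (H beta gamma : R -> nat -> R)
    (hP : forall eta : R, 0 < eta -> gen_charlier b eta (P eta) (H eta))
    (hrec : forall eta : R, 0 < eta ->
      recursion_coefs (P eta) (beta eta) (gamma eta))
    (n : nat) (hn : (1 <= n)%N) (eta : R) (heta : 0 < eta) :
  (forall k : nat, (k < 3)%N ->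
     derivable (derive1n k (fun t : R => gamma t n)) eta 1) /\
  theta (fun t : R =>
      gamma t n / t *
        (theta (theta (fun s : R => ln (gamma s n))) t + 2 * gamma t n)
      + n%:R ^+ 2 * (t / gamma t n)) eta
  = 2 * gamma eta n.
Proof.
case: n hn => // m _; split=> [k k3|].
  exact: gamma_derivable3 hb hP hrec m eta k heta k3.
exact: gen_charlier_ode hb hP hrec m eta heta.
Qed.
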